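(* Let $F,G\in\mathcal{F}^{n\times n}$ with $F$ singular and $sF-G$ a regular pencil, and let $B\in\mathcal{F}^{n\times l}$, $C\in\mathcal{F}^{m\times n}$, $k_0\in\mathbb{Z}$. Consider the system $$FY_{k+1}=GY_k+BV_k,\qquad X_k=CY_k,\qquad k\ge k_0,$$ and let $H_q$ and $B_q$ be the Weierstrass data described in the context. Then causality between state and inputs holds for this system if and only if $H_qB_q=0_{q,l}$ (the $q\times l$ zero matrix).
   Context: $\mathcal{F}$ is a field over which the Weierstrass decomposition below exists (e.g. $\mathcal{F}=\mathbb{C}$). The pencil $sF-G$ is regular if $\det(sF-G)$ is not the zero polynomial in the indeterminate $s$. $Y_k\in\mathcal{F}^n$ is the state, $V_k\in\mathcal{F}^l$ the input (an arbitrary sequence $(V_k)_{k\ge k_0}$), and $X_k\in\mathcal{F}^m$ the output. Causality between state and inputs: for every $k>k_0$ the state $Y_k$ is completely determined by the initial state $Y_{k_0}$ and the former inputs $V_{k_0},V_{k_0+1},\dots,V_k$. That is, if two solutions $(Y_k)$, $(Y_k')$ of the system correspond to input sequences $(V_k)$, $(V_k')$ with $Y_{k_0}=Y'_{k_0}$ and $V_i=V_i'$ for $k_0\le i\le k$, then $Y_k=Y'_k$. Weierstrass data: by regularity there are nonsingular $P,Q\in\mathcal{F}^{n\times n}$ with $PFQ=I_p\oplus H_q$ and $PGQ=J_p\oplus I_q$, where $p+q=n$ and $\oplus$ denotes block-diagonal direct sum. Here $J_p$ is a direct sum of Jordan blocks for the finite eigenvalues of the pencil, and $H_q$ is a direct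 sum of nilpotent Jordan blocks (ones on the superdiagonal, zeros elsewhere). Such $P,Q$ are fixed. Write $PB=\begin{bmatrix} B_p \\ B_q \end{bmatrix}$ with $B_p\in\mathcal{F}^{p\times l}$ and $B_q\in\mathcal{F}^{q\times l}$. *)

(* Defs.v *)
From mathcomp Require Import all_boot all_order all_algebra.

Set Implicit Arguments.
Unset Strict Implicit.
Unset Printing Implicit Defensive.

Import GRing.Theory Num.Theory.
Local Open Scope ring_scope.

Definition pencil (K : fieldType) (n : nat) (F G : 'M[K]_n) : 'M[{poly K}]_n :=
  'X *: map_mx polyC F - map_mx polyC G.

Definition regular_pencil (K : fieldType) (n : nat) (F G : 'M[K]_n) : Prop :=
  \det (pencil F G) != 0.

Definition finite_eigenvalue (K : fieldType) (n : nat) (F G : 'M[K]_n) (a : K) :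
    Prop :=
  root (\det (pencil F G)) a.

Definition jordan_block (K : fieldType) (a : K) (d : nat) : 'M[K]_d :=
  \matrix_(i, j) (if j == i then a else if j == i.+1 :> nat then 1 else 0).

(* The number r of blocks may be 0, which accounts for p = 0; the blocks
   themselves are nonempty. *)
Definition jordan_sum (K : fieldType) (spec : K -> Prop) (p : nat)
    (J : 'M[K]_p) : Prop :=
  exists (r : nat) (d : 'I_r -> nat) (a : 'I_r -> K)
         (e : (\sum_(i < r) d i)%N = p),
    (forall i, (0 < d i)%N /\ spec (a i)) /\
    J = castmx (e, e) (\mxdiag_(i < r) jordan_block (a i) (d i)).

(* P and Q bring the pencil sF - G to its Weierstrass canonical form. *)
Definition weierstrass_form (K : fieldType) (n p q : nat) (e : (p + q)%N = n)
    (F G P Q : 'M[K]_n) (J : 'M[K]_p) (H : 'M[K]_q) : Prop :=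
  [/\ P \in unitmx /\ Q \in unitmx,
      jordan_sum (finite_eigenvalue F G) J,
      jordan_sum (fun a => a = 0) H,
      P *m F *m Q = castmx (e, e) (block_mx 1%:M 0 0 H)
    & P *m G *m Q = castmx (e, e) (block_mx J 0 0 1%:M)].

(* Sequences indexed by k >= k0 are represented by functions on all of int,
   whose values below k0 are never looked at. *)
Definition solution (K : fieldType) (n l m : nat) (F G : 'M[K]_n)
    (B : 'M[K]_(n, l)) (C : 'M[K]_(m, n)) (k0 : int)
    (Y : int -> 'cV[K]_n) (V : int -> 'cV[K]_l) (X : int -> 'cV[K]_m) : Prop :=
  forall k : int, k0 <= k ->
    F *m Y (k + 1) = G *m Y k + B *m V k /\ X k = C *m Y k.

Definition causal_state_input (K : fieldType) (n l m : nat) (F G : 'M[K]_n)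
    (B : 'M[K]_(n, l)) (C : 'M[K]_(m, n)) (k0 : int) : Prop :=
  forall (Y Y' : int -> 'cV[K]_n) (V V' : int -> 'cV[K]_l)
         (X X' : int -> 'cV[K]_m),
    solution F G B C k0 Y V X -> solution F G B C k0 Y' V' X' ->
    forall k : int, k0 < k ->
      Y k0 = Y' k0 -> (forall i : int, k0 <= i <= k -> V i = V' i) ->
      Y k = Y' k.

(* Main.v *)
Require Import Defs.
From mathcomp Require Import all_boot all_order all_algebra.
From mathcomp Require Import zify.

Set Implicit Arguments.
Unset Strict Implicit.
Unset Printing Implicit Defensive.

Import GRing.Theory Num.Theory.
Local Open Scope ring_scope.

(** In the coordinates [Y = Q (z_p, z_q)] the system splits into the explicit
    recursion [z_p(k+1) = J z_p(k) + Bp V(k)] and the backward recursion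
    [z_q(k) = H z_q(k+1) - Bq V(k)], which, [H] being nilpotent, is solved by
    [z_q(k) = - \sum_i H^i Bq V(k+i)].  If [H Bq = 0], only the present input
    survives in this sum.  Conversely, if [H^(N+2) Bq = 0], a single input
    pulse [v] at time [k0+N+2], starting from the zero state, produces the
    state [z_q(k0+1) = - H^(N+1) Bq v] before the pulse occurs, so causality
    forces [H^(N+1) Bq = 0]; descending in the exponent gives [H Bq = 0]. *)

(** Each further factor [A] pushes the support up by one more diagonal: in the sum over [h] for
    [A * A ^+ k], either [h <= i] kills [A i h], or [i < h] and induction applies. *)
Lemma strict_upper_mx_exp (R : pzSemiRingType) (d : nat) (A : 'M[R]_d) :
  (forall i j : 'I_d, (j <= i)%N -> A i j = 0) ->
  forall (k : nat) (i j : 'I_d), (j < i + k)%N -> (A ^+ k) i j = 0.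
Proof.
move=> A0; elim=> [|k IHk] i j lt_j.
  rewrite expr0 mxE (_ : (i == j) = false) //.
  by apply/negbTE/eqP => ij; move: lt_j; rewrite ij addn0 ltnn.
rewrite exprS mxE big1 // => h _.
have [le_hi|lt_ih] := leqP h i; first by rewrite A0 ?mul0r.
by rewrite IHk ?mulr0 //; lia.
Qed.

Lemma jordan_block0_exp_eq0 (K : fieldType) (d k : nat) :
  (d <= k)%N -> jordan_block (0 : K) d ^+ k = 0.
Proof.
move=> le_dk; apply/matrixP => i j; rewrite [RHS]mxE.
apply: strict_upper_mx_exp => [{}i {}j le_ji|]; last first.
  by rewrite ltn_addl // (leq_trans (ltn_ord j)).
rewrite mxE; case: eqP => // _; case: eqP => // j_eq.
by move: le_ji; rewrite j_eq ltnn.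
Qed.

Lemma mul_mxdiag (R : pzSemiRingType) (r : nat) (d : 'I_r -> nat)
    (A B : forall i, 'M[R]_(d i)) :
  \mxdiag_i A i *m \mxdiag_i B i = \mxdiag_i (A i *m B i).
Proof.
rewrite [X in _ *m X]/mxdiag mul_mxdiag_mxblock; apply: eq_mxblock => i j.
by case: eqP => [<-|_]; rewrite ?conform_mx_id ?mulmx0.
Qed.

Lemma mxdiag_exp (R : pzSemiRingType) (r : nat) (d : 'I_r -> nat)
    (A : forall i, 'M[R]_(d i)) (k : nat) :
  (\mxdiag_i A i) ^+ k = \mxdiag_i (A i ^+ k).
Proof.
elim: k => [|k IHk].
  by rewrite expr0 -[1]/(1%:M) -mxdiagZ; apply: eq_mxdiag.
rewrite exprS IHk -[LHS]/(_ *m _) mul_mxdiag.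
by apply: eq_mxdiag => i; rewrite exprS.
Qed.

Lemma jordan_sum0_nilpotent (K : fieldType) (q : nat) (H : 'M[K]_q) :
  jordan_sum (fun a => a = 0) H -> exists N : nat, H ^+ N = 0.
Proof.
case=> r [d [a [e [a0 ->]]]]; subst q; rewrite castmx_id.
(* The total size bounds every block size, so this one exponent kills all blocks. *)
exists (\sum_i d i)%N; rewrite mxdiag_exp -[RHS]mxdiag0.
apply: eq_mxdiag => i; have [_ ->] := a0 i.
by apply: jordan_block0_exp_eq0; rewrite (bigD1 i) //= leq_addr.
Qed.

(** Multiplication by the invertible [P] loses nothing, hence an equivalence: one direction
    decomposes given solutions, the other certifies a constructed one. *)
Lemma weierstrass_split (K : fieldType) (p q l : nat)
    (F G P Q : 'M[K]_(p + q)) (J : 'M[K]_p) (H : 'M[K]_q)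
    (B : 'M[K]_(p + q, l)) (Bp : 'M[K]_(p, l)) (Bq : 'M[K]_(q, l))
    (zp zp' : 'cV[K]_p) (zq zq' : 'cV[K]_q) (v : 'cV[K]_l) :
  P \in unitmx ->
  P *m F *m Q = block_mx 1%:M 0 0 H -> P *m G *m Q = block_mx J 0 0 1%:M ->
  P *m B = col_mx Bp Bq ->
  F *m (Q *m col_mx zp' zq') = G *m (Q *m col_mx zp zq) + B *m v <->
  zp' = J *m zp + Bp *m v /\ H *m zq' = zq + Bq *m v.
Proof.
move=> Pu PFQ PGQ PB.
have PE : P *m (F *m (Q *m col_mx zp' zq')) =
    P *m (G *m (Q *m col_mx zp zq) + B *m v) <->
    zp' = J *m zp + Bp *m v /\ H *m zq' = zq + Bq *m v.
  rewrite mulmxDr !mulmxA PFQ PGQ PB !mul_block_col mul_col_mx add_col_mx.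
  rewrite !mul0mx !mul1mx !addr0 !add0r.
  by split=> [/eq_col_mx | [-> ->]].
split=> [/(congr1 (mulmx P))/PE // | /PE].
exact: (can_inj (mulKmx Pu)).
Qed.

Lemma solution_coordinates (K : fieldType) (p q l m : nat)
    (F G P Q : 'M[K]_(p + q)) (J : 'M[K]_p) (H : 'M[K]_q)
    (B : 'M[K]_(p + q, l)) (C : 'M[K]_(m, p + q)) (k0 : int)
    (Bp : 'M[K]_(p, l)) (Bq : 'M[K]_(q, l)) Y V X :
  P \in unitmx -> Q \in unitmx ->
  P *m F *m Q = block_mx 1%:M 0 0 H -> P *m G *m Q = block_mx J 0 0 1%:M ->
  P *m B = col_mx Bp Bq ->
  solution F G B C k0 Y V X ->
  exists zp zq, forall t : nat,
    [/\ Y (k0 + t%:Z) = Q *m col_mx (zp t) (zq t),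
        zp t.+1 = J *m zp t + Bp *m V (k0 + t%:Z)
      & H *m zq t.+1 = zq t + Bq *m V (k0 + t%:Z)].
Proof.
move=> Pu Qu PFQ PGQ PB sol.
pose z (t : nat) := invmx Q *m Y (k0 + t%:Z).
have YE t : Y (k0 + t%:Z) = Q *m col_mx (usubmx (z t)) (dsubmx (z t)).
  by rewrite vsubmxK mulKVmx.
exists (usubmx \o z), (dsubmx \o z) => t; split=> //=;
  have [|eqY _] := sol (k0 + t%:Z); rewrite ?lerDl //;
  move: eqY; rewrite -addrA -(PoszD t 1) addn1 !YE;
  by case/(weierstrass_split _ _ _ _ _ Pu PFQ PGQ PB).
Qed.

Lemma nilpotent_backward_solution (K : fieldType) (q l N : nat) (H : 'M[K]_q)
    (Bq : 'M[K]_(q, l)) (z : nat -> 'cV[K]_q) (v : nat -> 'cV[K]_l) :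
  H ^+ N = 0 -> H *m Bq = 0 ->
  (forall t, H *m z t.+1 = z t + Bq *m v t) ->
  forall t, z t = - (Bq *m v t).
Proof.
move=> HN HBq rec_z.
have zE t : z t = H *m z t.+1 - Bq *m v t by rewrite rec_z addrK.
have expSM s : H ^+ s.+1 = H ^+ s *m H by rewrite exprSr.
have Hz s t : H *m z t = H ^+ s.+1 *m z (t + s)%N.
  elim: s => [|s IHs]; first by rewrite expr1 addn0.
  rewrite IHs zE addnS mulmxBr mulmxA -expSM [X in _ - X]mulmxA (expSM s).
  by rewrite -(mulmxA _ H Bq) HBq mulmx0 mul0mx subr0.
move=> t; apply/eqP; rewrite -addr_eq0 -rec_z (Hz N).
by rewrite exprS HN mulr0 mul0mx.
Qed.

Lemma causality_sufficient (K : fieldType) (p q l m N : nat)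
    (F G P Q : 'M[K]_(p + q)) (J : 'M[K]_p) (H : 'M[K]_q)
    (B : 'M[K]_(p + q, l)) (C : 'M[K]_(m, p + q)) (k0 : int)
    (Bp : 'M[K]_(p, l)) (Bq : 'M[K]_(q, l)) :
  P \in unitmx -> Q \in unitmx ->
  P *m F *m Q = block_mx 1%:M 0 0 H -> P *m G *m Q = block_mx J 0 0 1%:M ->
  P *m B = col_mx Bp Bq ->
  H ^+ N = 0 -> H *m Bq = 0 ->
  causal_state_input F G B C k0.
Proof.
move=> Pu Qu PFQ PGQ PB HN HBq Y Y' V V' X X' sol sol' k lt_k Y0 eqV.
have [zp [zq eqs]] := solution_coordinates Pu Qu PFQ PGQ PB sol.
have [zp' [zq' eqs']] := solution_coordinates Pu Qu PFQ PGQ PB sol'.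
have [t kE] : exists t : nat, k = k0 + t%:Z by exists `|k - k0|%N; lia.
have eqVs (s : nat) : (s <= t)%N -> V (k0 + s%:Z) = V' (k0 + s%:Z).
  by move=> le_st; apply: eqV; lia.
have zqE : forall s, zq s = - (Bq *m V (k0 + s%:Z)).
  by apply: (nilpotent_backward_solution HN HBq) => s; case: (eqs s).
have zqE' : forall s, zq' s = - (Bq *m V' (k0 + s%:Z)).
  by apply: (nilpotent_backward_solution HN HBq) => s; case: (eqs' s).
(* The forward part needs only the common initial state, read off by cancelling [Q], and inputs at
   offsets below [t]. *)
have eq_zp (s : nat) : (s <= t)%N -> zp s = zp' s.
  elim: s => [_|s IHs lt_st].
    have [e0 _ _] := eqs 0; have [e0' _ _] := eqs' 0.
    move: e0 e0'; rewrite addr0 Y0 => -> /(can_inj (mulKmx Qu)).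
    by case/eq_col_mx.
  have [_ -> _] := eqs s; have [_ -> _] := eqs' s.
  by rewrite IHs ?eqVs // ltnW.
rewrite kE; have [-> _ _] := eqs t; have [-> _ _] := eqs' t.
by rewrite eq_zp // zqE zqE' eqVs.
Qed.

Lemma causality_lower_power (K : fieldType) (p q l m N : nat)
    (F G P Q : 'M[K]_(p + q)) (J : 'M[K]_p) (H : 'M[K]_q)
    (B : 'M[K]_(p + q, l)) (C : 'M[K]_(m, p + q)) (k0 : int)
    (Bp : 'M[K]_(p, l)) (Bq : 'M[K]_(q, l)) :
  P \in unitmx -> Q \in unitmx ->
  P *m F *m Q = block_mx 1%:M 0 0 H -> P *m G *m Q = block_mx J 0 0 1%:M ->
  P *m B = col_mx Bp Bq ->
  causal_state_input F G B C k0 ->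
  H ^+ N.+2 *m Bq = 0 -> H ^+ N.+1 *m Bq = 0.
Proof.
move=> Pu Qu PFQ PGQ PB causal HN2.
(* The claim is checked column by column, with a basis vector [v] as the pulse. *)
apply/trmx_inj/row_matrixP => j; rewrite -!tr_col col0 colE -mulmxA.
congr (_^T); set v := delta_mx j 0.
(* The pulse at offset [N.+2] reaches [zp] one step later, whereas [zq] anticipates it and vanishes
   afterwards. *)
pose zp t := if (t <= N.+2)%N then 0 else J ^+ (t - N.+3) *m (Bp *m v).
pose zq t := if (t <= N.+2)%N then - (H ^+ (N.+2 - t) *m (Bq *m v)) else 0.
pose Y (k : int) := Q *m col_mx (zp `|k - k0|%N) (zq `|k - k0|%N).
pose V (k : int) := if `|k - k0|%N == N.+2 then v else 0.
have sol : solution F G B C k0 Y V (fun k => C *m Y k).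
  move=> k le_k; split=> //; rewrite /Y /V.
  have -> : `|(k + 1 - k0)%R|%N = `|(k - k0)%R|%N.+1 by lia.
  move: `|(k - k0)%R|%N => t.
  apply/(weierstrass_split _ _ _ _ _ Pu PFQ PGQ PB); rewrite /zp /zq.
  case: (ltngtP t N.+2) => [lt_t|lt_t|->].
  - rewrite !mulmx0 !addr0 subSS; split=> //.
    by rewrite mulmxN (mulmxA H) -[H *m H ^+ _]/(H * _) -exprS -subSn.
  - by rewrite !mulmx0 !addr0 subSn // exprS -mulmxA.
  - by rewrite !mulmx0 subnn subSS subnn !expr0 !mul1mx add0r addNr.
have sol0 : solution F G B C k0 (fun=> 0) (fun=> 0) (fun=> 0).
  by move=> k _; rewrite !mulmx0 addr0.
(* Here [H ^+ N.+2 *m Bq = 0] enters: the pulse solution starts at zero and can be compared with the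
   zero solution. *)
have Yk0 : Y k0 = 0.
  by rewrite /Y subrr /zp /zq /= subn0 mulmxA HN2 mul0mx oppr0 col_mx0 mulmx0.
have := causal _ _ _ _ _ _ sol sol0 (k0 + 1).
rewrite ltrDl => /(_ isT Yk0) Yk1.
(* The pulse offset is at least 2, so both inputs agree at offsets 0 and 1. *)
have /Yk1 : forall i : int, k0 <= i <= k0 + 1 -> V i = 0.
  by move=> i le_i; rewrite /V; case: eqP => //; lia.
rewrite /Y [k0 + 1]addrC addrK /zp /zq /= -[RHS](mulmx0 _ Q).
move/(can_inj (mulKmx Qu)); rewrite -[RHS]col_mx0 => /eq_col_mx[_ /eqP].
by rewrite subSS subn0 oppr_eq0 => /eqP.
Qed.

Theorem proposition3p1 (K : fieldType) (n l m : nat)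
    (F G : 'M[K]_n) (B : 'M[K]_(n, l)) (C : 'M[K]_(m, n)) (k0 : int)
    (F_singular : F \notin unitmx) (FG_regular : regular_pencil F G)
    (p q : nat) (pq_n : (p + q)%N = n)
    (P Q : 'M[K]_n) (J : 'M[K]_p) (H : 'M[K]_q)
    (FG_weierstrass : weierstrass_form pq_n F G P Q J H)
    (Bp : 'M[K]_(p, l)) (Bq : 'M[K]_(q, l))
    (PB_blocks : P *m B = castmx (pq_n, erefl l) (col_mx Bp Bq)) :
  causal_state_input F G B C k0 <-> H *m Bq = 0.
Proof.
subst n; case: FG_weierstrass => [[Pu Qu] _ /jordan_sum0_nilpotent[N HN]].
move: PB_blocks; rewrite !castmx_id => PB PFQ PGQ.
split=> [causal|]; last exact: (causality_sufficient Pu Qu PFQ PGQ PB HN).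
(* The descent starts at the exponent [N.+1], where nilpotency gives the premise. *)
suff HBq s : H ^+ s.+1 *m Bq = 0 -> H *m Bq = 0.
  by apply: (HBq N); rewrite exprS HN mulr0 mul0mx.
elim: s => [|s IHs HBq]; first by rewrite expr1.
exact/IHs/(causality_lower_power Pu Qu PFQ PGQ PB causal).
Qed.
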